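(* Let $p,q\in\mathbb{N}$, $\alpha,\beta>-1$, $\lambda,\mu,r>0$ with $\alpha+\lambda\ge0$, $A_i,B_j>0$, $a_i,b_j\ge0$ ($1\le i\le p$, $1\le j\le q$). Let $\mathbf c=(c_n)_{n\ge1}$ be a real sequence with $0<c_1<c_2<\cdots$ and $c_n\uparrow\infty$, and let $c:\mathbb{R}_+\to\mathbb{R}_+$ be an increasing invertible function with $c(n)=c_n$ for all $n\in\mathbb{N}$, with inverse $c^{-1}$. For $\sigma\ge0$ let $V^{[\sigma]}$ denote the generalized Volterra function $V_{p+1,q}^{\alpha,\beta}$ with upper parameters $(a_1,A_1),\dots,(a_p,A_p),(\sigma,1)$ and lower parameters $(b_1,B_1),\dots,(b_q,B_q)$. Then the Mathieu-type series $$\mathcal K=\sum_{j=1}^\infty\frac{c_j^{-\lambda}}{(c_j+r)^\mu}\,V^{[\alpha+\lambda]}\Big(\frac r{c_j}\Big)$$ has the integral representation $$\mathcal K=K_{\mathbf c}^V(r,\lambda+1,\mu)+\mu\,K_{\mathbf c}^V(r,\lambda,\mu+1),$$ where, for $\lambda',\mu'>0$, $$K_{\mathbf c}^V(r,\lambda',\mu')=\int_{c_1}^\infty\frac{[c^{-1}(x)]}{x^{\lambda'}(x+r)^{\mu'}}\,V^{[\alpha+\lambda']}\Big(\frac rx\Big)\,dx$$ and $[a]$ denotes the integer part of the real number $a$.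
   Context: The generalized Volterra function with upper parameters $(a_i,A_i)_{1\le i\le p}$ and lower parameters $(b_j,B_j)_{1\le j\le q}$ ($A_i,B_j>0$, $a_i,b_j\ge0$, $\alpha,\beta>-1$) is $$V_{p,q}^{\alpha,\beta}(x)=\int_0^\infty \frac{\prod_{i=1}^p\Gamma(A_it+a_i)}{\prod_{j=1}^q\Gamma(B_jt+b_j)}\,\frac{x^{t+\alpha}t^\beta}{\Gamma(\beta+1)}\,dt,\qquad x>0.$$ It is understood that the parameters and the sequence $\mathbf c$ are such that the integrals defining the generalized Volterra functions, and the series $\mathcal K$, converge. *)

(* Defs.v *)
From HB Require Import structures.
From mathcomp Require Import all_boot all_order all_algebra.
From mathcomp Require Import all_classical all_reals all_analysis.
Set Implicit Arguments.
Unset Strict Implicit.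
Unset Printing Implicit Defensive.
Import Order.TTheory GRing.Theory Num.Theory.
Import numFieldNormedType.Exports.
Local Open Scope classical_set_scope.
Local Open Scope ring_scope.

(* Meaningful for s > 0 only; otherwise the integral diverges and Rintegral
   returns 0. *)
Definition Gamma (R : realType) (s : R) : R :=
  \int[lebesgue_measure]_(t in `]0, +oo[) (t `^ (s - 1) * expR (- t)).

(* A pair (a, A) contributes the factor Gamma (A t + a).  All the Gamma
   arguments are positive because t ranges over the open half-line, even
   when a = 0. *)
Definition volterra_integrand (R : realType) (p q : nat)
    (up : p.-tuple (R * R)) (lo : q.-tuple (R * R)) (alpha beta x t : R) : R :=
  (\prod_(i < p) Gamma ((tnth up i).2 * t + (tnth up i).1)) /
  (\prod_(j < q) Gamma ((tnth lo j).2 * t + (tnth lo j).1)) *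
  (x `^ (t + alpha) * t `^ beta / Gamma (beta + 1)).

Definition volterra (R : realType) (p q : nat)
    (up : p.-tuple (R * R)) (lo : q.-tuple (R * R)) (alpha beta x : R) : R :=
  \int[lebesgue_measure]_(t in `]0, +oo[)
    volterra_integrand up lo alpha beta x t.

(* The integrand is nonnegative on the half-line for the parameters of
   interest, so integrability is convergence of the improper integral. *)
Definition volterra_cvg (R : realType) (p q : nat)
    (up : p.-tuple (R * R)) (lo : q.-tuple (R * R)) (alpha beta x : R) : Prop :=
  lebesgue_measure.-integrable `]0, +oo[
    (EFin \o volterra_integrand up lo alpha beta x).

(* V^[sigma]: the pair (sigma, 1) is appended to the upper parameters. *)
Definition volterra_ext (R : realType) (p q : nat)
    (up : p.-tuple (R * R)) (lo : q.-tuple (R * R))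
    (alpha beta sigma x : R) : R :=
  volterra [tuple of rcons up (sigma, 1)] lo alpha beta x.

Definition volterra_ext_cvg (R : realType) (p q : nat)
    (up : p.-tuple (R * R)) (lo : q.-tuple (R * R))
    (alpha beta sigma x : R) : Prop :=
  volterra_cvg [tuple of rcons up (sigma, 1)] lo alpha beta x.

(* The sequence (c_n) is indexed from n = 1; the value cs 0 is never used. *)
Definition mathieu_volterra_term (R : realType) (p q : nat)
    (up : p.-tuple (R * R)) (lo : q.-tuple (R * R))
    (alpha beta lambda mu r : R) (cs : nat -> R) (j : nat) : R :=
  cs j `^ (- lambda) / (cs j + r) `^ mu *
  volterra_ext up lo alpha beta (alpha + lambda) (r / cs j).

Definition mathieu_volterra_partial (R : realType) (p q : nat)
    (up : p.-tuple (R * R)) (lo : q.-tuple (R * R))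
    (alpha beta lambda mu r : R) (cs : nat -> R) (n : nat) : R :=
  \sum_(1 <= j < n.+1) mathieu_volterra_term up lo alpha beta lambda mu r cs j.

Definition KV_integrand (R : realType) (p q : nat)
    (up : p.-tuple (R * R)) (lo : q.-tuple (R * R))
    (alpha beta : R) (cinv : R -> R) (r lambda mu x : R) : R :=
  (Num.floor (cinv x))%:~R / (x `^ lambda * (x + r) `^ mu) *
  volterra_ext up lo alpha beta (alpha + lambda) (r / x).

Definition KV (R : realType) (p q : nat)
    (up : p.-tuple (R * R)) (lo : q.-tuple (R * R))
    (alpha beta c1 : R) (cinv : R -> R) (r lambda mu : R) : R :=
  \int[lebesgue_measure]_(x in `]c1, +oo[)
    KV_integrand up lo alpha beta cinv r lambda mu x.

Definition KV_cvg (R : realType) (p q : nat)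
    (up : p.-tuple (R * R)) (lo : q.-tuple (R * R))
    (alpha beta c1 : R) (cinv : R -> R) (r lambda mu : R) : Prop :=
  lebesgue_measure.-integrable `]c1, +oo[
    (EFin \o KV_integrand up lo alpha beta cinv r lambda mu).

(* Main.v *)
(* Put s = alpha + lambda and
     W(t) = Gamma(t + s) r^(t + alpha) t^beta / Gamma(beta + 1)
            * prod Gamma(A_i t + a_i) / prod Gamma(B_j t + b_j).
   Then x^(-lambda) V^[s](r/x) is the integral of W(t) x^(-(t + s)), and, since
   Gamma(t + s + 1) = (t + s) Gamma(t + s), x^(-lambda-1) V^[s+1](r/x) is the
   integral of W(t) (t + s) x^(-(t + s) - 1).  For fixed t the function
   x^(-(t + s)) (x + r)^(-mu) vanishes at infinity and is minus the integral of
   its derivative, so Tonelli's theorem writes the j-th term of the series as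
   the integral over [c_j, +oo) of the integrand of the right-hand side
   without the integer part.  Summing over j brings in the number of j with
   c_j <= x, which is the integer part of c^{-1}(x).  All the integrands are
   nonnegative, so the convergence of the two integrals comes out of the
   computation. *)
Require Import Defs.
From HB Require Import structures.
From mathcomp Require Import all_boot all_order all_algebra.
From mathcomp Require Import all_classical all_reals all_analysis.
From mathcomp Require Import measurable_realfun ring.
Import Order.TTheory GRing.Theory Num.Theory.
Import numFieldNormedType.Exports.
Local Open Scope classical_set_scope.
Local Open Scope ring_scope.

(** * Tonelli's theorem on a measurable rectangle *)

Section tonelli_on.
Context {d1 d2 : measure_display} {T1 : measurableType d1}
  {T2 : measurableType d2} {R : realType}
  {m1 : {sigma_finite_measure set T1 -> \bar R}}
  {m2 : {sigma_finite_measure set T2 -> \bar R}}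
  {D1 : set T1} {D2 : set T2} {f : T1 * T2 -> \bar R}.
Hypotheses (mD1 : measurable D1) (mD2 : measurable D2).
Hypothesis mf : measurable_fun (D1 `*` D2) f.
Hypothesis f0 : forall x y, D1 x -> D2 y -> (0 <= f (x, y))%E.

Let patch_ge0 z : (0 <= (f \_ (D1 `*` D2)) z)%E.
Proof.
rewrite patchE; case: ifPn => //; rewrite inE; case: z => x y [/= Dx Dy].
exact: f0.
Qed.

Let measurable_patch : measurable_fun setT (f \_ (D1 `*` D2)).
Proof. by apply/(measurable_restrictT _ _).1 => //; exact: measurableX. Qed.

Let patch_F :
  (fun x => \int[m2]_(y in D2) f (x, y))%E \_ D1 =
  (fun x => \int[m2]_y (f \_ (D1 `*` D2)) (x, y))%E.
Proof.
apply/funext => x; rewrite patchE; case: ifPn => xD1.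
  rewrite integral_mkcond; apply: eq_integral => y _.
  by rewrite !patchE in_setX/= xD1.
by rewrite integral0_eq// => y _; rewrite patchE in_setX/= (negbTE xD1).
Qed.

Let patch_G :
  (fun y => \int[m1]_(x in D1) f (x, y))%E \_ D2 =
  (fun y => \int[m1]_x (f \_ (D1 `*` D2)) (x, y))%E.
Proof.
apply/funext => y; rewrite patchE; case: ifPn => yD2.
  rewrite integral_mkcond; apply: eq_integral => x _.
  by rewrite !patchE in_setX/= yD2 andbT.
by rewrite integral0_eq// => x _; rewrite patchE in_setX/= (negbTE yD2) andbF.
Qed.

Lemma measurable_fun_tonelli_on :
  measurable_fun D2 (fun y => \int[m1]_(x in D1) f (x, y))%E.
Proof.
apply/(measurable_restrictT _ mD2); rewrite patch_G.
exact: (measurable_fun_fubini_tonelli_G (m1 := m1) (f \_ (D1 `*` D2))).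
Qed.

(** Extending [f] by zero off the rectangle reduces this to the full-space theorem. Measurability
    and sign are then required on the rectangle only, which suits a weight controlled only for t >
    0. *)
Lemma tonelli_on :
  (\int[m1]_(x in D1) \int[m2]_(y in D2) f (x, y) =
   \int[m2]_(y in D2) \int[m1]_(x in D1) f (x, y))%E.
Proof.
rewrite integral_mkcond patch_F [RHS]integral_mkcond patch_G.
exact: (fubini_tonelli (f \_ (D1 `*` D2))).
Qed.

End tonelli_on.

(** Base and exponent both vary, since t sits in the exponent of the kernels below. The two branches
    of [powR] are treated separately: the indicator of a zero exponent at base 0, and exp (g ln f)
    elsewhere. *)
Lemma measurable_fun_powR {d} {T : measurableType d} {R : realType} {D : set T}
    {f g : T -> R} : measurable_fun D f -> measurable_fun D g ->
  measurable_fun D (fun x => f x `^ g x).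
Proof.
move=> mf mg mD; move: (mD); rewrite /powR; apply: measurable_fun_if => //.
- by apply: measurable_fun_eqr.
- apply: measurableT_comp => //; apply: measurable_fun_eqr => //.
  by apply: measurable_funS mg.
- apply: measurableT_comp => //; apply: measurable_funM.
    by apply: measurable_funS mg.
  apply: measurableT_comp => //.
  by apply: measurable_funS mf.
Qed.

(** * The functional equation of the Gamma function *)

Section Gamma_recurrence.
Context {R : realType}.
Local Notation mu := (@lebesgue_measure R).

Lemma integral_powR_oc (s b : R) : 0 < s -> 0 < b ->
  (\int[mu]_(u in `]0%R, b]) (s * u `^ (s - 1))%:E = (b `^ s)%:E)%E.
Proof.
move=> s0 b0.
(* Compact intervals exhausting ]0, b] keep away from the singularity at 0 that occurs when s < 1.
   The shift by 2 makes even the first one nondegenerate. *)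
pose D (n : nat) : set R := `[b / n.+2%:R, b]%classic.
have bn0 n : 0 < b / n.+2%:R by rewrite divr_gt0.
have bigcupD : \bigcup_n D n = `]0, b]%classic.
  apply/seteqP; split => [x [n _]|x]; rewrite /D /= !in_itv/=.
    by move=> /andP[+ ->]; rewrite andbT; exact: lt_le_trans.
  (* Since b / x < n + 1 for this n, b / (n + 2) lies below x. *)
  move=> /andP[x0 xb]; exists (Num.truncn (b / x)) => //=.
  rewrite in_itv/= xb andbT ler_pdivrMr// mulrC -ler_pdivrMr//.
  rewrite ltW// (lt_trans (truncnS_gt _))// ltr_nat.
  done.
have mf (A : set R) : measurable_fun A (fun u : R => (s * u `^ (s - 1))%:E).
  apply/measurable_funTS/measurable_EFinP; apply: measurable_funM => //.
have cvD : (\int[mu]_(u in D n) (s * u `^ (s - 1))%:E @[n --> \oo] -->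
    \int[mu]_(u in \bigcup_n D n) (s * u `^ (s - 1))%:E)%E.
  apply: ge0_nondecreasing_set_cvg_integral => //.
  - apply/nondecreasing_seqP => n; apply/subsetPset => x; rewrite /D/= !in_itv/=.
    move=> /andP[bx ->]; rewrite andbT (le_trans _ bx)// ler_wpM2l ?ltW//.
    by rewrite ltf_pV2 ?posrE// ltr_nat.
  - by move=> n; exact: measurable_itv.
  - by move=> n; exact: mf.
  - move=> n x; rewrite /D/= in_itv/= => /andP[bx _].
    by rewrite lee_fin mulr_ge0 ?powR_ge0// ltW.
(* By monotone convergence it remains to find the limit of the integrals over [D n]. They equal b^s
   - (b / (n + 2))^s, and x^s tends to 0 at 0+ because s > 0. *)
rewrite -bigcupD; apply: (cvg_unique _ cvD) => //.
have dpow (a x : R) : 0 < x -> is_derive x 1 (fun u => u `^ a) (a * x `^ (a - 1)).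
  by move=> x0; exact: is_derive1_powR.
have cpow (a x : R) : 0 < x -> {for x, continuous (fun u => u `^ a)}.
  move=> x0; apply: differentiable_continuous; apply/derivable1_diffP.
  by have [] := dpow a x x0.
rewrite (_ : (fun _ => _) = (fun n => (b `^ s - (b / n.+2%:R) `^ s)%:E)).
  apply: cvg_EFin; first exact: nearW.
  rewrite /comp/= -[X in _ --> X]subr0.
  apply: cvgB; first exact: cvg_cst.
  apply: (cvg_at_rightP (fun x => x `^ s) 0 0).1; first exact: powR_cvg0.
  split=> //; rewrite -[X in _ --> X](mulr0 b).
  apply: cvgMr.
  by have := @cvg_harmonic R; rewrite -cvg_shiftS.
apply/funext => n; rewrite /D EFinB.
have bnb : b / n.+2%:R < b by rewrite ltr_pdivrMr// ltr_pMr// ltr1n.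
apply: (@continuous_FTC2 _ _ (fun u => u `^ s)) => //.
- apply: continuous_in_subspaceT => x; rewrite inE/= in_itv/= => /andP[bx _].
  apply: cvgM; first exact: cvg_cst.
  exact/cpow/(lt_le_trans _ bx).
- split.
  + move=> x; rewrite in_itv/= => /andP[bx _].
    by have [] := dpow s x (lt_trans (bn0 n) bx).
  + exact/cvg_at_right_filter/cpow.
  + exact/cvg_at_left_filter/cpow.
- move=> x; rewrite in_itv/= => /andP[bx _].
  rewrite derive1E.
  by have /@derive_val := dpow s x (lt_trans (bn0 n) bx).
Qed.

Lemma measurable_expRN : measurable_fun [set: R] (fun t => expR (- t)).
Proof. by apply: measurableT_comp => //; exact: measurableT_comp. Qed.

Lemma integral_expRN_cy (u : R) :
  (\int[mu]_(t in `[u, +oo[) (expR (- t))%:E = (expR (- u))%:E)%E.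
Proof.
have dE (x : R) : is_derive x 1 (fun t : R => - expR (- t)) (expR (- x)).
  by apply: is_derive_eq; rewrite mulrN1 opprK.
rewrite (ge0_continuous_FTC2y (F := fun t => - expR (- t)) (l := 0)) //.
- by rewrite EFinN oppeK add0e.
- apply: continuous_subspaceT => x.
  by apply: continuous_comp; [exact: continuousN | exact: continuous_expR].
- by rewrite -[X in _ --> X]oppr0; apply: cvgN; exact: cvgr_expR.
- have cE : {for u, continuous (fun t : R => - expR (- t))}.
    by apply/differentiable_continuous/derivable1_diffP; have [] := dE u.
  exact: cvg_at_right_filter cE.
- by move=> x _; rewrite derive1E; have /@derive_val := dE x.
Qed.

(* Tonelli for s u^(s-1) e^(-t) over 0 < u <= t; unlike an integration by parts
   this avoids the singularity of t^(s-1) at 0 when s < 1. *)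
Lemma Gamma_rec (s : R) : 0 < s -> Gamma (s + 1) = s * Gamma s.
Proof.
move=> s0.
(* Here [z.1] is t and [z.2] is u. Integrating over u first leaves t^s e^(-t); integrating over t
   first leaves s u^(s-1) e^(-u). *)
pose f (z : R * R) : \bar R :=
  ((z.2 <= z.1)%R%:R * (s * z.2 `^ (s - 1) * expR (- z.1)))%:E.
pose D : set R := `]0, +oo[%classic.
have mD : measurable D by exact: measurable_itv.
have mf : measurable_fun (D `*` D) f.
  apply/measurable_EFinP/measurable_funTS; apply: measurable_funM.
    by apply: measurableT_comp => //; exact: measurable_fun_ler.
  apply: measurable_funM; last first.
    by apply: measurableT_comp => //; exact: measurableT_comp.
  by apply: measurable_funM => //; exact: measurable_fun_powR.
have f0 x y : D x -> D y -> (0 <= f (x, y))%E.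
  move=> _ _; rewrite lee_fin mulr_ge0// mulr_ge0 ?expR_ge0// mulr_ge0 ?powR_ge0//.
  exact: ltW.
have DE (x : R) : D x -> 0 < x by rewrite /D/= in_itv/= andbT.
have mg (A : set R) : measurable_fun A (fun y : R => (s * y `^ (s - 1))%:E).
  by apply/measurable_funTS/measurable_EFinP; exact: measurable_funM.
have tonelli : (\int[mu]_(x in D) \int[mu]_(y in D) f (x, y) =
    \int[mu]_(y in D) \int[mu]_(x in D) f (x, y))%E by exact: tonelli_on.
have intl : (\int[mu]_(x in D) \int[mu]_(y in D) f (x, y) =
    \int[mu]_(t in D) (t `^ (s + 1 - 1) * expR (- t))%:E)%E.
  apply: eq_integral => x; rewrite inE => /DE x0.
  transitivity (\int[mu]_(y in `]0%R, x])
      ((s * y `^ (s - 1))%:E * (expR (- x))%:E))%E; last first.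
    rewrite ge0_integralZr.
    - by rewrite addrK EFinM integral_powR_oc.
    - exact: measurable_itv.
    - exact: mg.
    - by move=> y _; rewrite lee_fin mulr_ge0 ?powR_ge0 ?ltW.
    - by rewrite lee_fin expR_ge0.
  rewrite -(setIidr (_ : `]0, x] `<=` D)); last first.
    by move=> y; rewrite /D/= !in_itv/= andbT => /andP[].
  rewrite integral_mkcondr; apply: eq_integral => y; rewrite inE => /DE y0.
  rewrite /f patchE mem_setE in_itv/= y0/=; case: ifP => _ /=.
    by rewrite mul1r EFinM.
  by rewrite mul0r.
have intr : (\int[mu]_(y in D) \int[mu]_(x in D) f (x, y) =
    s%:E * \int[mu]_(t in D) (t `^ (s - 1) * expR (- t))%:E)%E.
  rewrite -[RHS]ge0_integralZl; last 4 first.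
  - exact: mD.
  - apply/measurable_funTS/measurable_EFinP; apply: measurable_funM.
      exact: measurable_powR.
    exact: measurable_expRN.
  - by move=> t _; rewrite lee_fin mulr_ge0 ?powR_ge0 ?expR_ge0.
  - by rewrite lee_fin ltW.
  apply: eq_integral => y; rewrite inE => /DE y0.
  rewrite -EFinM mulrA [RHS]EFinM -integral_expRN_cy -[RHS]ge0_integralZl; last 4 first.
  - exact: measurable_itv.
  - apply/measurable_funTS/measurable_EFinP; exact: measurable_expRN.
  - by move=> t _; rewrite lee_fin expR_ge0.
  - by rewrite lee_fin mulr_ge0 ?powR_ge0 ?ltW.
  rewrite -(setIidr (_ : `[y, +oo[ `<=` D)); last first.
    by move=> t; rewrite /D/= !in_itv/= !andbT; exact: lt_le_trans.
  rewrite integral_mkcondr; apply: eq_integral => t; rewrite inE => /DE t0.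
  rewrite /f patchE mem_setE in_itv/= andbT; case: ifP => _ /=.
    by rewrite mul1r EFinM.
  by rewrite mul0r.
rewrite /Gamma /Rintegral -/D -intl tonelli intr.
(* Finiteness of the Gamma integral is not established: at an infinite value [fine] sends both sides
   to 0, so the identity persists. *)
case: (\int[mu]_(t in D) _)%E => [v||].
- by [].
- rewrite gt0_muley; last by rewrite lte_fin.
  by rewrite -[fine +oo%E]/(0 : R) mulr0.
- rewrite gt0_muleNy; last by rewrite lte_fin.
  by rewrite -[fine -oo%E]/(0 : R) mulr0.
Qed.

End Gamma_recurrence.

(** * The kernel identity for a fixed t *)

Section kernel.
Context {R : realType}.
Local Notation mu := (@lebesgue_measure R).

Lemma cvgr_powRN (s : R) : 0 < s -> x `^ (- s) @[x --> +oo] --> 0.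
Proof.
move=> s0; apply/cvgrPdist_le => e e0; near=> x.
(* The threshold M = e^(-1/s) solves M^(-s) = e. *)
have M0 : 0 < e `^ (- s^-1) by exact: powR_gt0.
have Mx : e `^ (- s^-1) <= x by near: x; apply: nbhs_pinfty_ge; exact: num_real.
have x0 := lt_le_trans M0 Mx.
rewrite sub0r normrN ger0_norm ?powR_ge0// powRN -[leRHS]invrK.
rewrite lef_pV2 ?posrE ?invr_gt0 ?powR_gt0//.
have -> : e^-1 = (e `^ (- s^-1)) `^ s.
  by rewrite -powRrM mulNr mulVf ?gt_eqF// powR_inv1// ltW.
apply: ge0_ler_powR => //; [exact: ltW|by rewrite nnegrE ltW|].
by rewrite nnegrE ltW.
Unshelve. end_near. Qed.

(** The integrand is the derivative of [F], which vanishes at infinity; as it is nonnegative, the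
    improper fundamental theorem of calculus applies. The exponent [s] will be instantiated with t +
    alpha + lambda. *)
Lemma integral_powR_kernel (s m r a : R) : 0 < s -> 0 < m -> 0 < r -> 0 < a ->
  (\int[mu]_(x in `[a, +oo[)
    (s * x `^ (- s - 1) * (x + r) `^ (- m) +
     m * (x `^ (- s) * (x + r) `^ (- m - 1)))%:E =
   (a `^ (- s) * (a + r) `^ (- m))%:E)%E.
Proof.
move=> s0 m0 r0 a0.
pose F (x : R) := - (x `^ (- s) * (x + r) `^ (- m)).
have dF (x : R) : 0 < x -> is_derive x 1 F
    (s * x `^ (- s - 1) * (x + r) `^ (- m) +
     m * (x `^ (- s) * (x + r) `^ (- m - 1))).
  move=> x0.
  have d1 := @is_derive1_powR R (- s) x x0.
  have d2 := @is_derive1_powR R (- m) (x + r) (addr_gt0 x0 r0).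
  have d3 : is_derive x 1 (fun y : R => (y + r) `^ (- m))
      (- m * (x + r) `^ (- m - 1)).
    have dr : is_derive x 1 (fun u : R => u + r) 1.
      by apply: is_derive_eq; rewrite addr0.
    have := @is_derive1_comp R _ (fun u => u + r) _ _ _ d2 dr.
    by rewrite mulr1.
  apply: is_derive_eq; rewrite /GRing.scale/=; ring.
have dpow (p y : R) : 0 < y -> {for y, continuous (fun u => u `^ p)}.
  move=> y0; apply: differentiable_continuous; apply/derivable1_diffP.
  by have [] := @is_derive1_powR R p y y0.
have cr (p y : R) : 0 < y -> {for y, continuous (fun u => (u + r) `^ p)}.
  move=> y0; apply: (@continuous_comp _ _ _ (fun u => u + r) (fun u => u `^ p)).
    by apply: cvgD; [exact: cvg_id|exact: cvg_cst].
  by apply: dpow; rewrite addr_gt0.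
rewrite (@ge0_continuous_FTC2y _ _ F _ 0).
- by rewrite /F EFinN oppeK add0e.
- move=> x ax; have x0 := lt_le_trans a0 ax.
  by rewrite addr_ge0// !mulr_ge0 ?powR_ge0 ?(ltW m0) ?(ltW s0).
- apply: continuous_in_subspaceT => x; rewrite inE/= in_itv/= andbT => ax.
  have x0 := lt_le_trans a0 ax.
  apply: cvgD; apply: cvgM.
  + by apply: cvgM; [exact: cvg_cst|exact: dpow].
  + exact: cr.
  + exact: cvg_cst.
  + by apply: cvgM; [exact: dpow|exact: cr].
- rewrite -[X in _ --> X]oppr0; apply: cvgN.
  rewrite -[X in _ --> X](mulr0 0); apply: cvgM; first exact: cvgr_powRN.
  apply: (@cvg_comp _ _ _ (fun x => x + r) (fun x => x `^ (- m)) _ +oo).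
    exact: cvg_addrr.
  exact: cvgr_powRN.
- by move=> x ax; have [] := dF x (lt_trans a0 ax).
- have cF : {for a, continuous F}.
    apply/differentiable_continuous/derivable1_diffP.
    by have [] := dF a a0.
  exact: cvg_at_right_filter cF.
- move=> x; rewrite in_itv/= andbT => ax.
  by rewrite derive1E; have /@derive_val := dF x (lt_trans a0 ax).
Qed.

End kernel.

(** * Counting indices: from a series of tail integrals to one integral *)

(* N x plays the role of the integer part of c^{-1}(x), and a j that of
   c_(j+1): the series is indexed from 1. *)
Section tail_sum.
Context {R : realType}.
Local Notation mu := (@lebesgue_measure R).
Variables (a : nat -> R) (N : R -> nat) (E : R -> \bar R).
Hypothesis a0_le : forall j, a 0%N <= a j.
Hypothesis aN : forall j x, a 0%N < x -> (a j <= x) = (j < N x)%N.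
Hypothesis mE : measurable_fun `[a 0%N, +oo[ E.
Hypothesis E0 : forall x, a 0%N <= x -> (0 <= E x)%E.

Let tail (j : nat) : R -> \bar R := E \_ `[a j, +oo[.

Let tail_ge0 j x : (0 <= tail j x)%E.
Proof.
rewrite /tail patchE; case: ifPn => //; rewrite inE/= in_itv/= andbT => ajx.
exact/E0/(le_trans (a0_le j)).
Qed.

Let measurable_tail j : measurable_fun `]a 0%N, +oo[ (tail j).
Proof.
apply: measurable_funS (_ : measurable_fun setT _) => //.
apply/(measurable_restrictT _ _).1 => //.
apply: measurable_funS mE => //.
by move=> x/=; rewrite !in_itv/= !andbT; exact: le_trans.
Qed.

Let sum_tail x : a 0%N < x ->
  (\sum_(j <oo) tail j x = (N x)%:R%:E * E x)%E.
Proof.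
move=> ax.
have tailE j : tail j x = if (j < N x)%N then E x else 0%E.
  by rewrite /tail patchE mem_setE in_itv/= andbT aN.
(* By [aN] only the indices below [N x] contribute at x, so the partial sums are constant from [N x]
   on. *)
apply: lim_near_cst => //; exists (N x) => // n /= Nn.
rewrite (big_cat_nat _ Nn)//= [X in (_ + X)%E]big1_seq ?adde0; last first.
  move=> j /=; rewrite mem_index_iota => /andP[Nj _].
  by rewrite tailE ltnNge Nj.
have -> : (\sum_(0 <= j < N x) tail j x = \sum_(0 <= j < N x) E x)%E.
  apply: eq_big_nat.
  by move=> j /andP[_ jN]; rewrite tailE jN.
by rewrite big_const_nat subn0 mule_natl; elim: (N x) => [|k IH];
  rewrite ?mule0n ?iterS ?IH ?muleS.
Qed.

Lemma measurable_tail_count :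
  measurable_fun `]a 0%N, +oo[ (fun x => (N x)%:R%:E * E x)%E.
Proof.
apply: (eq_measurable_fun (fun x => \sum_(j <oo | j \in predT) tail j x)%E).
  move=> x; rewrite inE/= in_itv/= andbT => /sum_tail <-.
  by [].
apply: ge0_emeasurable_sum => // j _; exact: measurable_tail.
Qed.

(** An integral form of summation by parts: the weight [N x] is the sum of the indicators of the
    tails, and a series of nonnegative functions may be integrated termwise. *)
Lemma integral_tail_count :
  (\int[mu]_(x in `]a 0%N, +oo[) ((N x)%:R%:E * E x) =
   \sum_(j <oo) \int[mu]_(x in `[a j, +oo[) E x)%E.
Proof.
transitivity (\int[mu]_(x in `]a 0%N, +oo[) \sum_(j <oo) tail j x)%E.
  apply: eq_integral => x; rewrite inE/= in_itv/= andbT => ax.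
  by rewrite sum_tail.
rewrite integral_nneseries//.
apply: eq_eseriesr => j _.
(* Adding the null point [a 0] to the domain makes it contain every closed tail, including the one
   with j = 0. *)
rewrite integral_itv_obnd_cbnd// -integral_mkcondr setIidr//.
by move=> x/=; rewrite !in_itv/= !andbT; exact: le_trans.
Qed.

End tail_sum.

Lemma Gamma_ge0 (R : realType) (s : R) : 0 <= Gamma s.
Proof. by apply: Rintegral_ge0 => t _; rewrite mulr_ge0 ?powR_ge0 ?expR_ge0. Qed.

Section sections.
Context {d1 d2 d : measure_display} {T1 : measurableType d1}
  {T2 : measurableType d2} {T : measurableType d}
  {D1 : set T1} {D2 : set T2} {f : T1 * T2 -> T}.
Hypotheses (mD1 : measurable D1) (mD2 : measurable D2).
Hypothesis mf : measurable_fun (D1 `*` D2) f.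

Lemma measurable_sectionr y : D2 y -> measurable_fun D1 (fun x => f (x, y)).
Proof.
move=> Dy; apply: (measurable_comp (F := D1 `*` D2)) => //.
- exact: measurableX.
- by move=> _ [x Dx <-].
- by apply: measurable_funTS; exact: pair2_measurable.
Qed.

End sections.

(** * Integrating the kernel identity against a weight in t *)

Section mixture.
Context {R : realType}.
Local Notation mu := (@lebesgue_measure R).
Variables (W : R -> R) (s m r : R).
Hypotheses (s0 : 0 <= s) (m0 : 0 < m) (r0 : 0 < r).
Hypothesis mW : measurable_fun `](0 : R), +oo[ W.
Hypothesis W0 : forall t, 0 < t -> 0 <= W t.

Let D1 : set R := `]0, +oo[%classic.

(* -(mixture1 + m mixture2) is the derivative of the integral over t of
   W(t) x^(-(t + s)) (x + r)^(-m), taken under the integral sign. *)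
Definition mixture1 (x : R) : \bar R := (\int[mu]_(t in `]0%R, +oo[)
  (W t * ((t + s) * x `^ (- (t + s) - 1) * (x + r) `^ (- m)))%:E)%E.

Definition mixture2 (x : R) : \bar R := (\int[mu]_(t in `]0%R, +oo[)
  (W t * (x `^ (- (t + s)) * (x + r) `^ (- m - 1)))%:E)%E.

Lemma mixture1_ge0 x : (0 <= mixture1 x)%E.
Proof.
apply: integral_ge0 => t; rewrite /= in_itv/= andbT => t0.
rewrite lee_fin mulr_ge0 ?W0// mulr_ge0 ?powR_ge0// mulr_ge0 ?powR_ge0//.
by rewrite addr_ge0// ltW.
Qed.

Lemma mixture2_ge0 x : (0 <= mixture2 x)%E.
Proof.
apply: integral_ge0 => t; rewrite /= in_itv/= andbT => t0.
by rewrite lee_fin mulr_ge0 ?W0// mulr_ge0 ?powR_ge0.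
Qed.

Section kernels.
Variable D2 : set R.
Hypothesis mD2 : measurable D2.

Let mts : measurable_fun (D1 `*` D2) (fun z : R * R => z.1 + s).
Proof.
apply: measurable_funD; last exact: measurable_cst.
by apply: measurable_funTS; exact: measurable_fst.
Qed.

Let mx : measurable_fun (D1 `*` D2) (fun z : R * R => z.2).
Proof. by apply: measurable_funTS; exact: measurable_snd. Qed.

Let mxr : measurable_fun (D1 `*` D2) (fun z : R * R => z.2 + r).
Proof. by apply: measurable_funD; [exact: mx|exact: measurable_cst]. Qed.

Let mD1 : measurable D1. Proof. exact: measurable_itv. Qed.

Let mW1 : measurable_fun (D1 `*` D2) (fun z : R * R => W z.1).
Proof.
apply: (measurable_comp (F := D1)) => //.
  by move=> _ [[t x] [/= Dt _] <-].
exact: measurable_funTS.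
Qed.

Lemma measurable_mixture1_kernel : measurable_fun (D1 `*` D2) (fun z : R * R =>
  (W z.1 * ((z.1 + s) * z.2 `^ (- (z.1 + s) - 1) * (z.2 + r) `^ (- m)))%:E).
Proof.
apply/measurable_EFinP; apply: measurable_funM; first exact: mW1.
apply: measurable_funM; last first.
  by apply: measurable_fun_powR; [exact: mxr|exact: measurable_cst].
apply: measurable_funM; first exact: mts.
apply: measurable_fun_powR; first exact: mx.
apply: measurable_funB; last exact: measurable_cst.
by apply: measurableT_comp; [exact: oppr_measurable|exact: mts].
Qed.

Lemma measurable_mixture2_kernel : measurable_fun (D1 `*` D2) (fun z : R * R =>
  (W z.1 * (z.2 `^ (- (z.1 + s)) * (z.2 + r) `^ (- m - 1)))%:E).
Proof.
apply/measurable_EFinP; apply: measurable_funM; first exact: mW1.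
apply: measurable_funM; last first.
  by apply: measurable_fun_powR; [exact: mxr|exact: measurable_cst].
apply: measurable_fun_powR; first exact: mx.
by apply: measurableT_comp; [exact: oppr_measurable|exact: mts].
Qed.

Lemma measurable_mixture1 : measurable_fun D2 mixture1.
Proof.
apply: (measurable_fun_tonelli_on (m1 := mu) mD1 mD2 measurable_mixture1_kernel).
move=> t x; rewrite /D1/= in_itv/= andbT => t0 _.
rewrite lee_fin mulr_ge0 ?W0// mulr_ge0 ?powR_ge0// mulr_ge0 ?powR_ge0//.
by rewrite addr_ge0// ltW.
Qed.

Lemma measurable_mixture2 : measurable_fun D2 mixture2.
Proof.
apply: (measurable_fun_tonelli_on (m1 := mu) mD1 mD2 measurable_mixture2_kernel).
move=> t x; rewrite /D1/= in_itv/= andbT => t0 _.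
by rewrite lee_fin mulr_ge0 ?W0// mulr_ge0 ?powR_ge0.
Qed.

End kernels.

(** The kernel identity at exponent t + s, positive because t > 0, is multiplied by W(t); Tonelli
    then exchanges t and x, and linearity separates the two parts. Nothing is assumed finite, so all
    of this takes place in the extended reals. *)
Lemma integral_mixture (a : R) : 0 < a ->
  (\int[mu]_(t in `]0%R, +oo[) (W t * (a `^ (- (t + s)) * (a + r) `^ (- m)))%:E =
   \int[mu]_(x in `[a, +oo[) mixture1 x +
   m%:E * \int[mu]_(x in `[a, +oo[) mixture2 x)%E.
Proof.
move=> a0.
pose D2 : set R := `[a, +oo[%classic.
have mD2 : measurable D2 by exact: measurable_itv.
have mD1 : measurable D1 by exact: measurable_itv.
have mK1 := measurable_mixture1_kernel D2.
have mK2 := measurable_mixture2_kernel D2.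
pose k1 (z : R * R) : R :=
  W z.1 * ((z.1 + s) * z.2 `^ (- (z.1 + s) - 1) * (z.2 + r) `^ (- m)).
pose k2 (z : R * R) : R :=
  W z.1 * (z.2 `^ (- (z.1 + s)) * (z.2 + r) `^ (- m - 1)).
have k10 t x : 0 < t -> 0 <= k1 (t, x).
  move=> t0; rewrite mulr_ge0 ?W0// mulr_ge0 ?powR_ge0// mulr_ge0 ?powR_ge0//.
  by rewrite addr_ge0// ltW.
have k20 t x : 0 < t -> 0 <= k2 (t, x).
  by move=> t0; rewrite mulr_ge0 ?W0// mulr_ge0 ?powR_ge0.
have D1E t : D1 t -> 0 < t by rewrite /D1/= in_itv/= andbT.
have mk2D : measurable_fun (D1 `*` D2) (fun z => m%:E * (k2 z)%:E)%E.
  by apply: measurable_funeM; exact: mK2.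
have mpow p : measurable_fun D2 (fun x : R => x `^ p).
  by apply: measurable_funTS; exact: measurable_powR.
have mpowr p : measurable_fun D2 (fun x : R => (x + r) `^ p).
  apply: measurable_fun_powR; last exact: measurable_cst.
  by apply: measurable_funD; [exact: measurable_id|exact: measurable_cst].
transitivity (\int[mu]_(t in D1) \int[mu]_(x in D2)
    ((k1 (t, x))%:E + m%:E * (k2 (t, x))%:E))%E.
  apply: eq_integral => t; rewrite inE => /D1E t0.
  rewrite EFinM -(integral_powR_kernel (t + s) m r a)//; last exact: ltr_wpDr.
  rewrite -ge0_integralZl.
  - apply: eq_integral => x _; rewrite -!EFinM -EFinD /k1 /k2/=.
    by rewrite mulrDr [m * (W t * _)]mulrCA.
  - exact: mD2.
  - apply/measurable_EFinP; apply: measurable_funD.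
      by apply: measurable_funM; [apply: measurable_funM|];
        [exact: measurable_cst|exact: mpow|exact: mpowr].
    by apply: measurable_funM; [exact: measurable_cst|apply: measurable_funM];
      [exact: mpow|exact: mpowr].
  - move=> x _; rewrite lee_fin addr_ge0// !mulr_ge0 ?powR_ge0 ?(ltW m0)//.
    by rewrite addr_ge0// ltW.
  - by rewrite lee_fin W0.
transitivity (\int[mu]_(x in D2) \int[mu]_(t in D1)
    ((k1 (t, x))%:E + m%:E * (k2 (t, x))%:E))%E.
  pose k z := ((k1 z)%:E + m%:E * (k2 z)%:E)%E.
  have T := tonelli_on (m1 := mu) (m2 := mu) (f := k) mD1 mD2.
  apply: T.
    by apply: emeasurable_funD; [exact: mK1|exact: mk2D].
  move=> t x /D1E t0 _; rewrite adde_ge0 ?mule_ge0 ?lee_fin ?k10 ?k20//.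
  exact: ltW.
transitivity (\int[mu]_(x in D2) (mixture1 x + m%:E * mixture2 x))%E.
  apply: eq_integral => x; rewrite inE => Dx.
  have mk1x := measurable_sectionr mD1 mD2 mK1 x Dx.
  have mk2x := measurable_sectionr mD1 mD2 mK2 x Dx.
  rewrite ge0_integralD.
  - by rewrite ge0_integralZl// => [t /D1E t0|]; rewrite lee_fin ?k20// ltW.
  - exact: mD1.
  - by move=> t /D1E t0; rewrite lee_fin k10.
  - exact: mk1x.
  - by move=> t /D1E t0; rewrite mule_ge0// lee_fin ?k20// ltW.
  - by apply: measurable_funeM; exact: mk2x.
have mM1 := measurable_mixture1 D2 mD2.
have mM2 := measurable_mixture2 D2 mD2.
rewrite ge0_integralD.
- by rewrite ge0_integralZl// => [x _|]; rewrite ?mixture2_ge0// lee_fin ltW.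
- exact: mD2.
- by move=> x _; exact: mixture1_ge0.
- exact: mM1.
- by move=> x _; rewrite mule_ge0 ?mixture2_ge0// lee_fin ltW.
- by apply: measurable_funeM; exact: mM2.
Qed.

End mixture.

(** * Dependence of the Volterra integrand on its argument *)

Section volterra_scaling.
Context {R : realType} {p q : nat}.
Variables (up : p.-tuple (R * R)) (lo : q.-tuple (R * R)) (alpha beta : R).
Local Notation mu := (@lebesgue_measure R).

Lemma volterra_integrand_rcons (sg x t : R) :
  volterra_integrand [tuple of rcons up (sg, 1)] lo alpha beta x t =
  volterra_integrand up lo alpha beta x t * Gamma (t + sg).
Proof.
rewrite /volterra_integrand.
rewrite -(big_tuple _ _ [tuple of rcons up (sg, 1)] predT
  (fun u => Gamma (u.2 * t + u.1))) big_rcons/= big_tuple mul1r.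
by rewrite -!mulrA [Gamma _ * _]mulrC !mulrA.
Qed.

Lemma volterra_integrand_ge0 (x t : R) :
  0 <= volterra_integrand up lo alpha beta x t.
Proof.
rewrite !mulr_ge0 ?invr_ge0 ?powR_ge0 ?Gamma_ge0// prodr_ge0// => i _;
  exact: Gamma_ge0.
Qed.

(** The argument enters only through the power (r / x)^(t + alpha). Hence a single weight W,
    independent of x, serves all the Volterra functions involved. *)
Lemma volterra_integrand_div (r x t : R) : 0 < r -> 0 < x ->
  volterra_integrand up lo alpha beta (r / x) t =
  volterra_integrand up lo alpha beta r t * x `^ (- (t + alpha)).
Proof.
move=> r0 x0; rewrite /volterra_integrand powRM ?ltW ?invr_gt0//.
rewrite -(powR_inv1 (ltW x0)) -powRrM mulN1r.
by set P := _ / _; ring.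
Qed.

End volterra_scaling.

(** Passage from the extended-real mixtures to the real-valued Volterra functions: integrability
    makes the integral of [f] finite, so [fine] loses nothing. *)
Lemma integral_eq_scale {R : realType} (D : set R) (f g : R -> R) (k : R) :
  measurable D ->
  (lebesgue_measure).-integrable D (EFin \o f) ->
  (forall t, D t -> g t = k * f t) ->
  (\int[lebesgue_measure]_(t in D) (g t)%:E)%E =
  (k * \int[lebesgue_measure]_(t in D) f t)%:E.
Proof.
move=> mD intf gE; rewrite EFinM fineK; last exact: integrable_fin_num.
rewrite -integralZl//; apply: eq_integral => t; rewrite inE => Dt.
by rewrite gE// EFinM.
Qed.
Theorem theorem5 (R : realType) (p q : nat)
  (up : p.-tuple (R * R)) (lo : q.-tuple (R * R))
  (alpha beta lambda mu r : R)
  (cs : nat -> R) (c cinv : R -> R)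
  (halpha : -1 < alpha) (hbeta : -1 < beta)
  (hlambda : 0 < lambda) (hmu : 0 < mu) (hr : 0 < r)
  (hal : 0 <= alpha + lambda)
  (hup : forall i : 'I_p, 0 <= (tnth up i).1 /\ 0 < (tnth up i).2)
  (hlo : forall j : 'I_q, 0 <= (tnth lo j).1 /\ 0 < (tnth lo j).2)
  (hcs1 : 0 < cs 1%N)
  (hcsS : forall n : nat, (0 < n)%N -> cs n < cs n.+1)
  (hcs_oo : cs @ \oo --> +oo)
  (hc_incr : forall x y : R, 0 <= x -> x < y -> c x < c y)
  (hc_bij : set_bij [set x : R | 0 <= x] [set y : R | 0 <= y] c)
  (hcinv : forall x : R, 0 <= x -> cinv (c x) = x)
  (hc_cs : forall n : nat, (0 < n)%N -> c n%:R = cs n)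
  (hV_series : forall j : nat, (0 < j)%N ->
     volterra_ext_cvg up lo alpha beta (alpha + lambda) (r / cs j))
  (hV_int : forall x : R, cs 1%N < x ->
     volterra_ext_cvg up lo alpha beta (alpha + lambda) (r / x) /\
     volterra_ext_cvg up lo alpha beta (alpha + (lambda + 1)) (r / x))
  (hK : cvgn (mathieu_volterra_partial up lo alpha beta lambda mu r cs)) :
  [/\ KV_cvg up lo alpha beta (cs 1%N) cinv r (lambda + 1) mu,
      KV_cvg up lo alpha beta (cs 1%N) cinv r lambda (mu + 1) &
      limn (mathieu_volterra_partial up lo alpha beta lambda mu r cs) =
        KV up lo alpha beta (cs 1%N) cinv r (lambda + 1) mu +
        mu * KV up lo alpha beta (cs 1%N) cinv r lambda (mu + 1)].

Proof.

(* Volterra functions as mixtures with the weight W *)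
pose s := alpha + lambda.
pose W t := volterra_integrand up lo alpha beta r t * Gamma (t + s).
have W0 t : 0 < t -> 0 <= W t.
  by move=> _; rewrite mulr_ge0 ?volterra_integrand_ge0 ?Gamma_ge0.
have WE x t : 0 < x ->
    volterra_integrand [tuple of rcons up (s, 1)] lo alpha beta (r / x) t =
    W t * x `^ (- (t + alpha)).
  move=> x0; rewrite volterra_integrand_rcons volterra_integrand_div// /W.
  by rewrite mulrAC.
have WE1 x t : 0 < x -> 0 < t ->
    volterra_integrand [tuple of rcons up (alpha + (lambda + 1), 1)] lo
      alpha beta (r / x) t =
    (t + s) * (W t * x `^ (- (t + alpha))).
  move=> x0 t0; rewrite volterra_integrand_rcons volterra_integrand_div// /W.
  rewrite !addrA Gamma_rec /s; first by ring.
  by rewrite -addrA ltr_pwDl.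
have mW : measurable_fun `](0 : R), +oo[ W.
  have /integrableP[/measurable_EFinP mV _] := hV_series 1%N isT.
  (* Measurability of W is read off the convergence of the Volterra integral at r / c_1, by
     cancelling the factor c_1^(-(t + alpha)). *)
  apply: (eq_measurable_fun (fun t =>
    volterra_integrand [tuple of rcons up (s, 1)] lo alpha beta (r / cs 1%N) t *
    cs 1%N `^ (t + alpha))).
    move=> t _; rewrite WE// -mulrA -powRD ?addNr ?powRr0 ?mulr1//.
    by apply/implyP => _; rewrite gt_eqF.
  apply: measurable_funM; first exact: mV.
  apply: measurable_fun_powR; first exact: measurable_cst.
  by apply: measurable_funD; [exact: measurable_id|exact: measurable_cst].
have powsplit x (u : R) : 0 < x ->
    x `^ (- (u + s)) = x `^ (- (u + alpha)) * x `^ (- lambda).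
  move=> x0; rewrite -powRD; last by apply/implyP => _; rewrite gt_eqF.
  by rewrite /s addrA opprD.
have powsplit1 x (u : R) : 0 < x ->
    x `^ (- (u + s) - 1) = x `^ (- (u + alpha)) * x `^ (- (lambda + 1)).
  move=> x0; rewrite -powRD; last by apply/implyP => _; rewrite gt_eqF.
  by congr (_ `^ _); rewrite /s; ring.
have mD : measurable (`](0 : R), +oo[%classic : set R) by exact: measurable_itv.
have mix1E x : 0 < x ->
    volterra_ext_cvg up lo alpha beta (alpha + (lambda + 1)) (r / x) ->
    mixture1 W s mu r x = (x `^ (- (lambda + 1)) * (x + r) `^ (- mu) *
      volterra_ext up lo alpha beta (alpha + (lambda + 1)) (r / x))%:E.
  move=> x0 itV; apply: (integral_eq_scale _ _ _ _ mD itV) => t.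
  rewrite /= in_itv/= andbT => t0.
  by rewrite WE1// powsplit1//; ring.
have mix2E x : 0 < x ->
    volterra_ext_cvg up lo alpha beta (alpha + lambda) (r / x) ->
    mixture2 W s mu r x = (x `^ (- lambda) * (x + r) `^ (- (mu + 1)) *
      volterra_ext up lo alpha beta (alpha + lambda) (r / x))%:E.
  move=> x0 itV; apply: (integral_eq_scale _ _ _ _ mD itV) => t.
  rewrite /= in_itv/= andbT => t0.
  by rewrite WE// powsplit// [- (mu + 1)]opprD; ring.
have cs_le j : cs 1%N <= cs j.+1.
  by elim: j => // j /le_trans; apply; exact/ltW/hcsS.
have cs_gt0 j : 0 < cs j.+1 := lt_le_trans hcs1 (cs_le j).

(* The terms of the series as tail integrals *)
pose term j := mathieu_volterra_term up lo alpha beta lambda mu r cs j.+1.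
have termE j : (term j)%:E =
    (\int[lebesgue_measure]_(x in `[cs j.+1, +oo[) mixture1 W s mu r x +
     mu%:E * \int[lebesgue_measure]_(x in `[cs j.+1, +oo[) mixture2 W s mu r x)%E.
  rewrite -(integral_mixture W s mu r)//.
  rewrite (integral_eq_scale _ _ _ (cs j.+1 `^ (- lambda) *
    (cs j.+1 + r) `^ (- mu)) mD (hV_series j.+1 isT)).
    by rewrite /term /mathieu_volterra_term [(cs j.+1 + r) `^ (- mu)]powRN.
  move=> t; rewrite /= in_itv/= andbT => t0.
  by rewrite WE// powsplit//; ring.

(* The integer part of c^{-1} as a counting function *)
pose N x := `|Num.floor (cinv x)|%N.
have cinv_ge0 x : 0 <= x -> exists2 y, 0 <= y & c y = x /\ cinv x = y.
  (* Surjectivity of [c] onto the nonnegative reals turns the left inverse [cinv] into a right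
     inverse there. *)
  move=> x0; have [_ _ /(_ x x0)[y y0 cy]] := hc_bij.
  by exists y => //; split => //; rewrite -cy hcinv.
have NE x : 0 <= x -> (Num.floor (cinv x))%:~R = (N x)%:R :> R.
  move=> /cinv_ge0[y y0 [_ cinvx]]; rewrite /N cinvx.
  have f0 : 0 <= Num.floor y by rewrite floor_ge0.
  by rewrite -{1}(gez0_abs f0).
have csN j x : cs 1%N < x -> (cs j.+1 <= x) = (j < N x)%N.
  move=> csx; have [y y0 [cyx cinvx]] := cinv_ge0 x (ltW (lt_trans hcs1 csx)).
  rewrite -hc_cs// -cyx.
  (* Strict monotonicity of [c] transfers the comparison to its arguments; j + 1 <= y then means j +
     1 <= floor y, that is j < N x. *)
  have -> : (c j.+1%:R <= c y) = (j.+1%:R <= y).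
    apply/idP/idP; last first.
      rewrite le_eqVlt => /predU1P[->//|jy].
      by apply/ltW/hc_incr.
    by apply: contraTT; rewrite -!ltNge; exact: hc_incr.
  rewrite /N cyx cinvx -[j.+1%:R]/(j.+1%:Z%:~R) -floor_ge_int.
  by rewrite -lez_nat gez0_abs// floor_ge0.
have itvE x : x \in `]cs 1%N, +oo[%classic -> cs 1%N < x.
  by rewrite inE/= in_itv/= andbT.
have mC : measurable (`[cs 1%N, +oo[%classic : set R) by exact: measurable_itv.
pose E1 := mixture1 W s mu r; pose E2 := mixture2 W s mu r.
have E1ge0 x : (0 <= E1 x)%E by exact: mixture1_ge0.
have E2ge0 x : (0 <= E2 x)%E by exact: mixture2_ge0.
have mE1 : measurable_fun `[cs 1%N, +oo[ E1 by exact: measurable_mixture1.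
have mE2 : measurable_fun `[cs 1%N, +oo[ E2 by exact: measurable_mixture2.
pose KV1 := KV_integrand up lo alpha beta cinv r (lambda + 1) mu.
pose KV2 := KV_integrand up lo alpha beta cinv r lambda (mu + 1).
have KV1E x : cs 1%N < x -> (KV1 x)%:E = ((N x)%:R%:E * E1 x)%E.
  move=> csx; have x0 := lt_trans hcs1 csx.
  rewrite /E1 (mix1E x x0 (hV_int x csx).2).
  rewrite -EFinM /KV1 /KV_integrand NE ?ltW//; congr EFin.
  by rewrite !powRN invfM !mulrA.
have KV2E x : cs 1%N < x -> (KV2 x)%:E = ((N x)%:R%:E * E2 x)%E.
  move=> csx; have x0 := lt_trans hcs1 csx.
  rewrite /E2 (mix2E x x0 (hV_int x csx).1).
  rewrite -EFinM /KV2 /KV_integrand NE ?ltW//; congr EFin.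
  by rewrite !powRN invfM !mulrA.

(* The two integrals as series of tail integrals *)
pose X1 := (\int[lebesgue_measure]_(x in `]cs 1%N, +oo[) (KV1 x)%:E)%E.
pose X2 := (\int[lebesgue_measure]_(x in `]cs 1%N, +oo[) (KV2 x)%:E)%E.
have X1int : X1 = (\int[lebesgue_measure]_(x in `]cs 1%N, +oo[) (KV1 x)%:E)%E by exact: erefl.
have X2int : X2 = (\int[lebesgue_measure]_(x in `]cs 1%N, +oo[) (KV2 x)%:E)%E by exact: erefl.
have K1E : KV up lo alpha beta (cs 1%N) cinv r (lambda + 1) mu = fine X1 by exact: erefl.
have K2E : KV up lo alpha beta (cs 1%N) cinv r lambda (mu + 1) = fine X2 by exact: erefl.
pose a j := cs j.+1.
have X1E : X1 = (\sum_(j <oo) \int[lebesgue_measure]_(x in `[a j, +oo[) E1 x)%E.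
  rewrite -(integral_tail_count a N E1 cs_le csN mE1 (fun x _ => E1ge0 x)).
  by apply: eq_integral => x /itvE; exact: KV1E.
have X2E : X2 = (\sum_(j <oo) \int[lebesgue_measure]_(x in `[a j, +oo[) E2 x)%E.
  rewrite -(integral_tail_count a N E2 cs_le csN mE2 (fun x _ => E2ge0 x)).
  by apply: eq_integral => x /itvE; exact: KV2E.
have mu_ge0 : (0 <= mu%:E)%E by rewrite lee_fin ltW.

(* Summation, finiteness and conclusion *)
set L := limn _.
have sumL : (X1 + mu%:E * X2 = L%:E)%E.
  rewrite X1E X2E -nneseriesZl; last by move=> j _; exact: integral_ge0.
  rewrite -nneseriesD; last 2 first.
  - by move=> j _ _; exact: integral_ge0.
  - by move=> j _ _; apply: mule_ge0 => //; exact: integral_ge0.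
  rewrite /L -EFin_lim//; congr (limn _); apply/funext => n.
  (* Shifting the index by one matches the sum over 1 <= j <= n with the first n values of
     [term]. *)
  rewrite /= /mathieu_volterra_partial big_add1/= -sumEFin.
  by apply: eq_bigr => j _; rewrite -termE.
have X1ge0 : (0 <= X1)%E.
  by rewrite X1E; apply: nneseries_ge0 => j _ _; exact: integral_ge0.
have X2ge0 : (0 <= X2)%E.
  by rewrite X2E; apply: nneseries_ge0 => j _ _; exact: integral_ge0.
clearbody X1 X2.
(* Both summands of X1 + mu X2 = L are nonnegative and L is a real number, so neither can be
   infinite; mu > 0 is what passes this on to X2. *)
have X1lty : (X1 < +oo)%E.
  rewrite (le_lt_trans _ (ltry L))// -sumL leeDl//.
  exact: mule_ge0.
have X2lty : (X2 < +oo)%E.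
  rewrite ltey; apply/negP => /eqP X2y; move: sumL.
  rewrite X2y gt0_muley; last by rewrite lte_fin.
  by move: X1ge0; case: (X1) => [x1| |].
have mKV1 : measurable_fun `]cs 1%N, +oo[ (EFin \o KV1).
  apply: (eq_measurable_fun (fun x => (N x)%:R%:E * E1 x)%E).
    by move=> x /itvE /KV1E.
  exact: (measurable_tail_count a N E1 cs_le csN mE1 (fun x _ => E1ge0 x)).
have mKV2 : measurable_fun `]cs 1%N, +oo[ (EFin \o KV2).
  apply: (eq_measurable_fun (fun x => (N x)%:R%:E * E2 x)%E).
    by move=> x /itvE /KV2E.
  exact: (measurable_tail_count a N E2 cs_le csN mE2 (fun x _ => E2ge0 x)).
split.
- rewrite /KV_cvg; apply/integrableP; split; first exact: mKV1.
  (* The integrand is nonnegative on the domain, so the integral of its absolute value is X1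
     itself. *)
  apply: le_lt_trans X1lty; rewrite X1int le_eqVlt; apply/predU1P; left.
  apply: eq_integral => x /itvE csx.
  by rewrite gee0_abs//= KV1E//; apply: mule_ge0.
- rewrite /KV_cvg; apply/integrableP; split; first exact: mKV2.
  apply: le_lt_trans X2lty; rewrite X2int le_eqVlt; apply/predU1P; left.
  apply: eq_integral => x /itvE csx.
  by rewrite gee0_abs//= KV2E//; apply: mule_ge0.
- rewrite K1E K2E; apply: EFin_inj; rewrite -sumL EFinD EFinM !fineK//.
  + by rewrite ge0_fin_numE.
  + by rewrite ge0_fin_numE.
Qed.
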